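(* Let $\eta:[0,\pi/2]\to[0,1]$ be any real function, and for $\theta\in\Theta=[0,\pi/2]$ let $\mathcal{E}_\theta(\rho)=E_0\rho E_0^\dagger+E_1\rho E_1^\dagger$ with $E=\begin{pmatrix}\cos\theta&\sin\theta\\-\sin\theta&\cos\theta\end{pmatrix}$, $E_0=\sqrt{\eta_\theta}\,E$, $E_1=\sqrt{1-\eta_\theta}\,ZE$, $Z=\mathrm{diag}(1,-1)$. Then there is an estimation protocol which uses $\mathcal{E}_\theta$ a total of $N$ times and outputs an estimator $\hat\theta$ whose root mean squared error $\sqrt{E(\hat\theta-\theta)^2}$ is $O(\log N/N)$, uniformly in $\theta\in\Theta$.
   Context: An estimation protocol may prepare arbitrary $\theta$-independent (possibly entangled) input states, apply the channel $\mathcal{E}_\theta$ to subsystems in parallel and/or sequence, interleave $\theta$-independent operations, measure, and compute an estimate from the classical outcomes; $N$ counts the total number of uses of $\mathcal{E}_\theta$. *)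

(* Defs.v *)
From HB Require Import structures.
From mathcomp Require Import all_boot all_order all_algebra.
From mathcomp Require Import all_classical all_reals all_analysis.
From mathcomp Require Import complex mxtens.
Set Implicit Arguments. Unset Strict Implicit. Unset Printing Implicit Defensive.
Import Order.TTheory GRing.Theory Num.Theory.
Local Open Scope ring_scope.
Local Open Scope complex_scope.

Section Quantum.
Variable R : realType.
Local Notation C := R[i].

Definition adj {m n : nat} (A : 'M[C]_(m, n)) : 'M[C]_(n, m) :=
  (map_mx (@conjc R) A)^T.

Definition psd {n : nat} (A : 'M[C]_n) : Prop :=
  A = adj A /\ forall v : 'cV[C]_n, 0 <= (adj v *m A *m v) 0 0.

Definition density {n : nat} (rho : 'M[C]_n) : Prop :=
  psd rho /\ \tr rho = 1.

Definition kraus_tp {n : nat} (ks : seq 'M[C]_n) : Prop :=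
  \sum_(K <- ks) adj K *m K = 1%:M.

Definition kraus_apply {n : nat} (ks : seq 'M[C]_n) (rho : 'M[C]_n) : 'M[C]_n :=
  \sum_(K <- ks) K *m rho *m adj K.

Definition povm {n m : nat} (M : 'I_m -> 'M[C]_n) : Prop :=
  (forall k, psd (M k)) /\ \sum_(k < m) M k = 1%:M.

Definition rotE (t : R) : 'M[C]_2 :=
  \matrix_(i < 2, j < 2)
    (if (i == 0) && (j == 0) then (cos t)%:C
     else if (i == 0) && (j == 1) then (sin t)%:C
     else if (i == 1) && (j == 0) then (- sin t)%:C
     else (cos t)%:C).

Definition pauliZ : 'M[C]_2 :=
  \matrix_(i < 2, j < 2) (if i == j then (if i == 0 then 1 else -1) else 0).

Definition kraus0 (eta : R -> R) (t : R) : 'M[C]_2 :=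
  (Num.sqrt (eta t))%:C *: rotE t.
Definition kraus1 (eta : R -> R) (t : R) : 'M[C]_2 :=
  (Num.sqrt (1 - eta t))%:C *: (pauliZ *m rotE t).

Definition chan (eta : R -> R) (t : R) (rho : 'M[C]_2) : 'M[C]_2 :=
  kraus_apply [:: kraus0 eta t; kraus1 eta t] rho.

Definition chan_probe (eta : R -> R) (t : R) {d : nat} (rho : 'M[C]_(2 * d)) :
  'M[C]_(2 * d) :=
  kraus_apply [:: kraus0 eta t *t (1%:M : 'M[C]_d); kraus1 eta t *t (1%:M : 'M[C]_d)] rho.

(* A general estimation protocol with N uses of the channel: an initial state of
   probe qubit ⊗ ancilla (ancilla dimension d), then N rounds, each consisting of one
   use of E_theta on the probe followed by an arbitrary theta-independent channel
   on the whole system; finally a POVM with m outcomes and an estimator. *)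
Record protocol (N : nat) := Protocol {
  anc_dim : nat;
  init : 'M[C]_(2 * anc_dim);
  ops : nat -> seq 'M[C]_(2 * anc_dim);
  n_out : nat;
  meas : 'I_n_out -> 'M[C]_(2 * anc_dim);
  estim : 'I_n_out -> R
}.
Arguments anc_dim {N} p.
Arguments init {N} p.
Arguments ops {N} p _.
Arguments n_out {N} p.
Arguments meas {N} p _.
Arguments estim {N} p _.

Definition protocol_valid (N : nat) (P : protocol N) : Prop :=
  density (init P) /\ (forall k, (k < N)%N -> kraus_tp (ops P k)) /\ povm (meas P).

Fixpoint state (N : nat) (P : protocol N) (eta : R -> R) (t : R) (k : nat)
  : 'M[C]_(2 * anc_dim P) :=
  match k with
  | 0%N => init P
  | k'.+1 => kraus_apply (ops P k') (chan_probe eta t (state P eta t k'))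
  end.

Definition outcome_prob (N : nat) (P : protocol N) (eta : R -> R) (t : R)
  (o : 'I_(n_out P)) : R :=
  complex.Re (\tr (meas P o *m @state N P eta t N)).

Definition mse (N : nat) (P : protocol N) (eta : R -> R) (t : R) : R :=
  \sum_(o < n_out P) @outcome_prob N P eta t o * (estim P o - t) ^+ 2.

End Quantum.

(* Main.v *)
(** [rotE t] has the [t]-independent eigenvectors [(1, i)] and [(1, -i)], with eigenvalues [expi t] and [expi (- t)], and [pauliZ] exchanges them. If an ancilla register dictates which of the two the probe is in, a [pauliZ] error moves the probe to the orthogonal eigenvector; a correction controlled by the register detects and undoes it, so the protocol acts as if noiseless whatever [eta] is.

Branch [k < N] of the register uses the first eigenvector in exactly [k] of the [N] rounds and thus acquires the phase [expi (2 * k * t)], up to a common phase. A Fourier measurement of the register then estimates [2 * t]. With amplitudes [sin (pi * k / N)], summation by parts and Parseval's identity turn the expected squared chordal error into the sum of squared increments of the amplitudes, [2 * (1 - cos (pi / N)) <= (pi / N) ^+ 2]. *)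
Require Import Defs.
From HB Require Import structures.
From mathcomp Require Import all_boot all_order all_algebra.
From mathcomp Require Import all_classical all_reals all_analysis.
From mathcomp Require Import complex mxtens.
From mathcomp Require Import ring lra zify.
Import Order.TTheory GRing.Theory Num.Theory.
Import numFieldNormedType.Exports.
Local Open Scope ring_scope.
Local Open Scope complex_scope.
Set Implicit Arguments.
Unset Strict Implicit.
Unset Printing Implicit Defensive.

(** * Chord and arc estimates, and the increments of sampled sines *)

Section Trigonometry.
Variable R : realType.
Implicit Types x y t : R.

Lemma sin_mean_value x : 0 < x -> exists2 c, 0 < c < x & sin x = cos c * x.
Proof.
move=> x0; have [|c] := @MVT R sin cos 0 x x0 (fun y _ => is_derive_sin y).
  by apply: continuous_subspaceT => y; exact: continuous_sin.
by rewrite in_itv /= sin0 !subr0 => cx ->; exists c.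
Qed.

Lemma sin_le_id x : 0 <= x -> sin x <= x.
Proof.
rewrite le_eqVlt => /orP[/eqP<-|x0]; first by rewrite sin0.
have [c _ ->] := sin_mean_value x0.
by rewrite ler_piMl ?cos_le1// ltW.
Qed.

(** The double angle formula and the mean value theorem at [x / 2] write [sin x] as
    [x * cos (x / 2) * cos c] with [c < x / 2]. The product of cosines is at least
    [cos (x / 2) ^+ 2], hence at least one half because [cos x] is nonnegative. *)
Lemma sin_ge_half x : 0 <= x <= pi / 2 -> x / 2 <= sin x.
Proof.
move=> /andP[]; rewrite le_eqVlt => /orP[/eqP<-|x0 xpi].
  by rewrite sin0 mul0r.
have y0 : 0 < x / 2 by rewrite divr_gt0.
have [c /andP[c0 cy] sinE] := sin_mean_value y0.
have pi0 := @pi_gt0 R.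
have ch : cos (x / 2) <= cos c.
  by apply/ltW; rewrite ltr_cos // in_itv /=; apply/andP; split; lra.
have -> : sin x = cos (x / 2) * (cos c * (x / 2)) *+ 2.
  by rewrite -sinE -sin_mulr2n mulr2n -splitr.
have cx0 : 0 <= cos x by apply: cos_ge0_pihalf; lra.
have : cos x = cos (x / 2) ^+ 2 *+ 2 - 1 by rewrite -cos_mulr2n mulr2n -splitr.
have h0 : 0 <= cos (x / 2) by apply: cos_ge0_pihalf; lra.
move=> cosE.
have h1 : 1 / 2 <= cos (x / 2) * cos c.
  have : cos (x / 2) * cos (x / 2) <= cos (x / 2) * cos c by rewrite ler_wpM2l.
  rewrite -expr2; lra.
have : (x / 2) * (1 / 2) <= (x / 2) * (cos (x / 2) * cos c) by rewrite ler_wpM2l// ltW.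
have -> : cos (x / 2) * (cos c * (x / 2)) = x / 2 * (cos (x / 2) * cos c) by ring.
lra.
Qed.

Lemma one_sub_cos x : 1 - cos x = 2 * sin (x / 2) ^+ 2.
Proof.
have -> : cos x = cos (x / 2 *+ 2) by rewrite mulr2n -splitr.
by rewrite cos_mulr2n cos2sin2 mulr2n; ring.
Qed.

Lemma one_sub_cos_le x : 0 <= x <= pi -> 2 * (1 - cos x) <= x ^+ 2.
Proof.
move=> /andP[x0 xpi]; rewrite one_sub_cos.
have := @sin_le_id (x / 2); have : 0 <= sin (x / 2) by rewrite sin_ge0_pi //; lra.
have : 0 <= x / 2 by lra.
by nra.
Qed.

(** [2 * (1 - cos x)] is the squared chord of the arc [x]; up to a half circle the chord is at least
    half the arc. *)
Lemma one_sub_cos_ge x : `|x| <= pi -> x ^+ 2 / 4 <= 2 * (1 - cos x).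
Proof.
move=> xpi; rewrite -cos_norm one_sub_cos -(real_normK (num_real x)).
have x0 := normr_ge0 x.
have : `|x| / 2 / 2 <= sin (`|x| / 2) by apply: sin_ge_half; lra.
by nra.
Qed.

(* Replacing the angle [p] by its reflection into the upper half circle does not increase its chordal distance to any point of the upper half circle. *)
Lemma cos_acos_sub_ge p x : 0 <= x <= pi -> cos (p - x) <= cos (acos (cos p) - x).
Proof.
move=> xpi; have p1 : -1 <= cos p <= 1 by rewrite cos_geN1 cos_le1.
rewrite !cosB acosK ?in_itv// sin_acos// -sin2cos2 sqrtr_sqr lerD2l.
by rewrite ler_wpM2r ?ler_norm// sin_ge0_pi.
Qed.

(** The angle [2 * t] lies in the upper half circle, so folding [p] into it by [acos (cos p)] does
    not lengthen the chord. Halving the folded angle yields the factor [1 / 4] of the chord-arc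
    bound. *)
Lemma estimator_error p t : 0 <= t <= pi / 2 ->
  (acos (cos p) / 2 - t) ^+ 2 <= 2 * (1 - cos (2 * t - p)).
Proof.
move=> /andP[t0 tpi]; have pi0 := @pi_gt0 R.
have p1 : -1 <= cos p <= 1 by rewrite cos_geN1 cos_le1.
have := @cos_acos_sub_ge p (2 * t); rewrite -[cos (2 * t - p)]cosN opprB.
have := acos_ge0 p1; have := acos_lepi p1.
set q := acos _ => qpi q0.
have := @one_sub_cos_ge (q - 2 * t).
rewrite ler_norml => ge_sqr reflect.
have {}ge_sqr : (q - 2 * t) ^+ 2 / 4 <= 2 * (1 - cos (q - 2 * t)) by apply: ge_sqr; lra.
have {}reflect : cos (p - 2 * t) <= cos (q - 2 * t) by apply: reflect; lra.
have -> : (q / 2 - t) ^+ 2 = (q - 2 * t) ^+ 2 / 4 by field.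
lra.
Qed.

(** Sampled sines are eigenvectors of the discrete Laplacian, by the recurrence [rec]. The step
    [pi / n] makes them vanish at [0] and [n], so index shifts leave the sums unchanged. *)
Lemma sin_step_sqr_sum n (h := pi / n%:R : R) : (0 < n)%N ->
  \sum_(k < n) (sin (h * k.+1%:R) - sin (h * k%:R)) ^+ 2 =
  2 * (1 - cos h) * \sum_(k < n) sin (h * k%:R) ^+ 2.
Proof.
move=> n0; set s := fun k : nat => sin (h * k%:R).
have s0 : s 0%N = 0 by rewrite /s mulr0 sin0.
have sn : s n = 0 by rewrite /s mulfVK ?sinpi// pnatr_eq0 -lt0n.
have shift f : f n = f 0%N -> \sum_(k < n) f k.+1 = \sum_(k < n) f k :> R.
  move=> fn; apply: (@addrI _ (f 0%N)).
  by rewrite -(big_ord_recl n (fun i => f i)) big_ord_recr /= fn addrC.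
have rec k : s k.+2 + s k = 2 * cos h * s k.+1.
  have -> : s k.+2 = sin (h * k.+1%:R + h) by rewrite /s -[k.+2]addn1 natrD mulrDr mulr1.
  have -> : s k = sin (h * k.+1%:R - h) by rewrite /s -[k.+1]addn1 natrD mulrDr mulr1 addrK.
  by rewrite /s sinD sinB; ring.
have sqr_shift : \sum_(k < n) s k.+1 ^+ 2 = \sum_(k < n) s k ^+ 2.
  by rewrite (shift (fun k => s k ^+ 2)) // s0 sn.
have mul_shift : \sum_(k < n) s k.+2 * s k.+1 = \sum_(k < n) s k.+1 * s k.
  by rewrite (shift (fun k => s k.+1 * s k)) // s0 sn !mulr0.
have corr : 2 * \sum_(k < n) s k.+1 * s k = 2 * cos h * \sum_(k < n) s k ^+ 2.
  rewrite mulr2n mulrDl mul1r -{1}mul_shift -big_split -sqr_shift mulr_sumr /=.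
  apply: eq_bigr => k _; rewrite [s k.+1 * s k]mulrC -mulrDl rec; ring.
transitivity (\sum_(k < n) s k.+1 ^+ 2 + \sum_(k < n) s k ^+ 2
              - 2 * \sum_(k < n) s k.+1 * s k).
  rewrite -big_split mulr_sumr -sumrB /=; apply: eq_bigr => k _; rewrite /s; ring.
rewrite corr sqr_shift /s; ring.
Qed.

End Trigonometry.

(** * Adjoints, pure states and Kraus maps *)

Section Adjoint.
Variable R : realType.
Local Notation C := R[i].

Lemma adjointE m n (A : 'M[C]_(m, n)) i j : adj A i j = (A j i)^*%C.
Proof. by rewrite !mxE. Qed.

Lemma adjointK m n (A : 'M[C]_(m, n)) : adj (adj A) = A.
Proof. by apply/matrixP => i j; rewrite !adjointE conjcK. Qed.

Lemma adjointM m n p (A : 'M[C]_(m, n)) (B : 'M[C]_(n, p)) :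
  adj (A *m B) = adj B *m adj A.
Proof. by rewrite /adj map_mxM trmx_mul. Qed.

Lemma adjointZ m n (a : C) (A : 'M[C]_(m, n)) : adj (a *: A) = a^*%C *: adj A.
Proof. by rewrite /adj map_mxZ linearZ. Qed.

Lemma adjoint1 n : adj 1%:M = 1%:M :> 'M[C]_n.
Proof. by rewrite /adj map_mx1 trmx1. Qed.

Lemma adjoint_tens m n p q (A : 'M[C]_(m, n)) (B : 'M[C]_(p, q)) :
  adj (A *t B) = adj A *t adj B.
Proof. by rewrite /adj map_mxT trmx_tens. Qed.

Lemma psd_gram m n (K : 'M[C]_(m, n)) : psd (adj K *m K).
Proof.
split=> [|v]; first by rewrite adjointM adjointK.
rewrite mulmxA -adjointM -mulmxA mxE sumr_ge0// => i _.
by rewrite adjointE mulrC mulcJ_ge0.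
Qed.

(** The projector of a pure state when [v] is a unit vector; the corrected protocol stays in states
    of this form. *)
Definition outer n (v : 'cV[C]_n) : 'M[C]_n := v *m adj v.

Lemma outerZ n (a : C) (v : 'cV[C]_n) : outer (a *: v) = (a * a^*%C) *: outer v.
Proof. by rewrite /outer adjointZ -scalemxAl -scalemxAr scalerA. Qed.

Lemma outer0 n : outer (0 : 'cV[C]_n) = 0.
Proof. by rewrite /outer mul0mx. Qed.

Lemma psd_outer n (v : 'cV[C]_n) : psd (outer v).
Proof. by rewrite /outer -{1}[v]adjointK; exact: psd_gram. Qed.

Lemma trace_mul_outer n (M : 'M[C]_n) (v : 'cV[C]_n) :
  \tr (M *m outer v) = (adj v *m (M *m v)) 0 0.
Proof. by rewrite /outer mulmxA mxtrace_mulC [LHS]big_ord1. Qed.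

Lemma kraus_applyD n (ks : seq 'M[C]_n) (A B : 'M[C]_n) :
  kraus_apply ks (A + B) = kraus_apply ks A + kraus_apply ks B.
Proof.
by rewrite -big_split; apply: eq_bigr => K _; rewrite mulmxDr mulmxDl.
Qed.

Lemma kraus_applyZ n (ks : seq 'M[C]_n) a (A : 'M[C]_n) :
  kraus_apply ks (a *: A) = a *: kraus_apply ks A.
Proof.
by rewrite scaler_sumr; apply: eq_bigr => K _; rewrite -scalemxAr -scalemxAl.
Qed.

Lemma kraus_apply_outer2 n (K L : 'M[C]_n) v :
  kraus_apply [:: K; L] (outer v) = outer (K *m v) + outer (L *m v).
Proof. by rewrite /kraus_apply !big_cons big_nil addr0 /outer !adjointM !mulmxA. Qed.

Lemma kraus_apply2_mix n (K L : 'M[C]_n) p q v w :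
  kraus_apply [:: K; L] (p *: outer v + q *: outer w) =
  p *: (outer (K *m v) + outer (L *m v)) + q *: (outer (K *m w) + outer (L *m w)).
Proof. by rewrite kraus_applyD !kraus_applyZ !kraus_apply_outer2. Qed.

Lemma kraus_tp2 n (K L : 'M[C]_n) :
  adj K *m K + adj L *m L = 1%:M -> kraus_tp [:: K; L].
Proof. by rewrite /kraus_tp !big_cons big_nil addr0. Qed.

End Adjoint.

(** * Operators on the probe controlled by the ancilla register *)

Section BlockDiagonal.
Variables (R : realType) (n : nat).
Local Notation C := R[i].

(* The isomorphism of [C^2 (x) C^n] with [n]-tuples of vectors of [C^2], under which operators controlled by the ancilla become block diagonal. *)
Definition block_vec (g : 'I_n -> 'cV[C]_2) : 'cV[C]_(2 * n) :=
  \col_i g (mxtens_unindex i).2 (mxtens_unindex i).1 0.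

Definition block_diag (B : 'I_n -> 'M[C]_2) : 'M[C]_(2 * n) :=
  \matrix_(i, j) (B (mxtens_unindex i).2 (mxtens_unindex i).1 (mxtens_unindex j).1
                  *+ ((mxtens_unindex i).2 == (mxtens_unindex j).2)).

Lemma sum_mxtens_unindex (F : 'I_2 -> 'I_n -> C) :
  \sum_(i < 2 * n) F (mxtens_unindex i).1 (mxtens_unindex i).2 =
  \sum_k \sum_a F a k.
Proof.
rewrite exchange_big pair_big (reindex (@mxtens_index 2 n)).
  by apply: eq_bigr => i _; rewrite mxtens_indexK.
by exists (@mxtens_unindex 2 n) => i _; rewrite ?mxtens_indexK ?mxtens_unindexK.
Qed.

Lemma eq_block_vec g h : g =1 h -> block_vec g = block_vec h.
Proof. by move=> gh; apply/matrixP => i j; rewrite !mxE gh. Qed.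

Lemma block_vecZ a g : a *: block_vec g = block_vec (fun k => a *: g k).
Proof. by apply/matrixP => i j; rewrite !mxE. Qed.

Lemma sum_block_pick (F : 'I_2 -> 'I_n -> C) k :
  \sum_l \sum_a (F a l *+ (k == l)) = \sum_a F a k.
Proof.
rewrite (bigD1 k) //= [X in _ + X]big1 ?addr0 => [|l /negPf lk].
  by apply: eq_bigr => a _; rewrite eqxx.
by apply: big1 => a _; rewrite eq_sym lk.
Qed.

Lemma mul_block_diag_vec B g :
  block_diag B *m block_vec g = block_vec (fun k => B k *m g k).
Proof.
apply/matrixP => i j; rewrite !mxE.
rewrite -(sum_block_pick (fun a k => B k (mxtens_unindex i).1 a * g k a 0)).
rewrite -(sum_mxtens_unindex (fun a k => (B k _ a * g k a 0) *+ (_ == k))).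
apply: eq_bigr => l _; rewrite !mxE.
by case: eqP => [->|_]; rewrite ?mulr1n ?mulr0n ?mul0r.
Qed.

Lemma mul_block_diag B B' :
  block_diag B *m block_diag B' = block_diag (fun k => B k *m B' k).
Proof.
apply/matrixP => i j; rewrite !mxE -sumrMnl.
rewrite -(sum_block_pick (fun a k =>
  (B k (mxtens_unindex i).1 a * B' k a (mxtens_unindex j).1)
    *+ (k == (mxtens_unindex j).2))).
rewrite -(sum_mxtens_unindex (fun a k => (B k _ a * B' k a _) *+ (k == _) *+ (_ == k))).
apply: eq_bigr => l _; rewrite !mxE.
by case: eqP => [->|_]; rewrite ?mulr1n ?mulr0n ?mul0r ?mulrnAr.
Qed.

Lemma adjoint_block_diag B : adj (block_diag B) = block_diag (fun k => adj (B k)).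
Proof.
apply/matrixP => i j; rewrite adjointE !mxE eq_sym.
by case: eqP => [->|_]; rewrite ?mulr1n ?mulr0n ?conjc0 ?adjointE.
Qed.

Lemma block_diagD B B' :
  block_diag B + block_diag B' = block_diag (fun k => B k + B' k).
Proof. by apply/matrixP => i j; rewrite !mxE mulrnDl. Qed.

Lemma tens1_block_diag (A : 'M[C]_2) : A *t (1%:M : 'M[C]_n) = block_diag (fun=> A).
Proof. by apply/matrixP => i j; rewrite !mxE mulr_natr. Qed.

Lemma block_diag1 B : (forall k, B k = 1%:M) -> block_diag B = 1%:M.
Proof.
move=> B1; apply/matrixP => i j; rewrite !mxE B1 mxE -mulrnA mulnb.
by rewrite -(can_eq (@mxtens_unindexK 2 n) i j) -pair_eqE.
Qed.

Lemma dot_block_vec g h :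
  (adj (block_vec g) *m block_vec h) 0 0 = \sum_k (adj (g k) *m h k) 0 0.
Proof.
rewrite mxE (eq_bigr (fun i => (g (mxtens_unindex i).2 (mxtens_unindex i).1 0)^*%C *
                               h (mxtens_unindex i).2 (mxtens_unindex i).1 0)).
  rewrite (sum_mxtens_unindex (fun a k => (g k a 0)^*%C * h k a 0)).
  by apply: eq_bigr => k _; rewrite mxE; apply: eq_bigr => a _; rewrite adjointE.
by move=> i _; rewrite adjointE !mxE.
Qed.

(** If all blocks are multiples of one vector [f], the state is a product, and an operator on the
    register acts on the coefficients alone. *)
Lemma mul_1tens_block_vec (B : 'M[C]_n) (c : 'cV[C]_n) f :
  ((1%:M : 'M[C]_2) *t B) *m block_vec (fun k => c k 0 *: f) =
  block_vec (fun k => (B *m c) k 0 *: f).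
Proof.
apply/matrixP => i j; rewrite !mxE.
rewrite (eq_bigr (fun l =>
    (1%:M : 'M[C]_2) (mxtens_unindex i).1 (mxtens_unindex l).1 *
    B (mxtens_unindex i).2 (mxtens_unindex l).2 *
    (c (mxtens_unindex l).2 0 * f (mxtens_unindex l).1 0))).
  rewrite (sum_mxtens_unindex (fun a k => (1%:M : 'M[C]_2) _ a * B _ k * (c k 0 * f a 0))).
  rewrite mulr_suml; apply: eq_bigr => k _.
  rewrite (bigD1 (mxtens_unindex i).1) //= big1 ?addr0 => [|a /negPf ai].
    by rewrite mxE eqxx mul1r mulrA.
  by rewrite mxE eq_sym ai !mul0r.
by move=> l _; rewrite !mxE.
Qed.

Lemma kraus_tp2_block_diag B B' :
  (forall k, adj (B k) *m B k + adj (B' k) *m B' k = 1%:M) ->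
  kraus_tp [:: block_diag B; block_diag B'].
Proof.
move=> BB1; apply: kraus_tp2.
by rewrite (adjoint_block_diag B) (adjoint_block_diag B') 2!mul_block_diag block_diagD block_diag1.
Qed.

Lemma kraus_apply_tens1_block_vec (K L : 'M[C]_2) g :
  kraus_apply [:: K *t (1%:M : 'M[C]_n); L *t (1%:M : 'M[C]_n)] (outer (block_vec g)) =
  outer (block_vec (fun k => K *m g k)) + outer (block_vec (fun k => L *m g k)).
Proof.
rewrite [LHS]kraus_apply_outer2 (tens1_block_diag K) (tens1_block_diag L).
by congr (outer _ + outer _); exact: mul_block_diag_vec.
Qed.

Lemma outer_block_vec_sqrtZ (x : R) (A : 'M[C]_2) g : 0 <= x ->
  outer (block_vec (fun k => ((Num.sqrt x)%:C *: A) *m g k)) =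
  x%:C *: outer (block_vec (fun k => A *m g k)).
Proof.
move=> x0; rewrite (@eq_block_vec _ (fun k => (Num.sqrt x)%:C *: (A *m g k))).
  by rewrite -block_vecZ outerZ conjc_real -[_%:C * _]rmorphM -expr2 sqr_sqrtr.
by move=> k; rewrite -scalemxAl.
Qed.

End BlockDiagonal.

(** * Unit complex numbers and the discrete Fourier transform *)

Section Fourier.
Variable R : realType.
Local Notation C := R[i].
Implicit Types x y t : R.

Lemma conjcM (a b : C) : (a * b)^*%C = a^*%C * b^*%C.
Proof. exact: rmorphM. Qed.

Lemma conjcX (a : C) k : (a ^+ k)^*%C = a^*%C ^+ k.
Proof. exact: rmorphXn. Qed.

Definition expi x : C := cos x +i* sin x.

Lemma expi0 : expi 0 = 1.
Proof. by rewrite /expi cos0 sin0. Qed.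

Lemma expiD x y : expi (x + y) = expi x * expi y.
Proof. by rewrite /expi cosD sinD; simpc; rewrite [in X in _ +i* X]addrC [sin x * _]mulrC. Qed.

Lemma conj_expi x : (expi x)^*%C = expi (- x).
Proof. by rewrite /expi cosN sinN. Qed.

Lemma expi_conjr x : expi x * (expi x)^*%C = 1.
Proof. by rewrite conj_expi -expiD subrr expi0. Qed.

Lemma expiMn x k : expi (x *+ k) = expi x ^+ k.
Proof. by elim: k => [|k IHk]; rewrite ?mulr0n ?expi0// mulrS expiD IHk exprS. Qed.

Lemma expi_2pi : expi (2 * pi) = 1.
Proof. by rewrite /expi -[2]/(1 *+ 2) mulr_natl cos2pi sin2pi. Qed.

Lemma expi_eq1 x : 0 < `|x| < 2 * pi -> expi x != 1.
Proof.
move=> /andP[x0 xpi]; apply/eqP => -[cosx _].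
have := one_sub_cos `|x|; rewrite cos_norm cosx subrr => /eqP.
have sin_gt0 : 0 < sin (`|x| / 2) by apply: sin_gt0_pi; apply/andP; split; lra.
by rewrite lt_eqF// mulr_gt0// exprn_gt0.
Qed.

Lemma sub_expi_sqr x : (expi x - 1) * (expi x - 1)^*%C = (2 * (1 - cos x))%:C.
Proof.
rewrite /expi; simpc; congr (_ +i* _); last by ring.
have := cos2Dsin2 x; nra.
Qed.

(** The conjugate makes row [j] cancel the phases [expi x ^+ k] with [x = 2 * pi / n * j], so that
    outcome [j] signals the angle [x]. *)
Definition fourier n : 'M[C]_n :=
  \matrix_(j, k) ((Num.sqrt n%:R)^-1%:C * (expi (2 * pi / n%:R) ^+ (j * k))^*%C).

(** Each entry of the product is a geometric sum in a quotient [z] of two [N]-th roots of unity: it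
    is full if [z = 1], and vanishes otherwise since [z ^+ N = 1]. *)
Lemma fourier_unitary n : adj (fourier n) *m fourier n = 1%:M.
Proof.
case: n => [|n]; first by apply/matrixP => -[].
set N := n.+1; pose h : R := 2 * pi / N%:R.
apply/matrixP => k l; rewrite mxE.
set z := expi h ^+ k * (expi h ^+ l)^*%C.
have -> : \sum_j adj (fourier N) k j * fourier N j l = N%:R^-1%:C * \sum_(j < N) z ^+ j.
  rewrite mulr_sumr; apply: eq_bigr => j _.
  rewrite adjointE !mxE -/h conjcM conjcK conjc_real mulrACA.
  rewrite -[_%:C * _%:C]rmorphM -invfM -expr2 sqr_sqrtr// /z exprMn conjcX.
  by rewrite conjcX -!exprM ![(j * _)%N]mulnC.
rewrite mxE; have [kl|kl] := eqVneq k l.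
  rewrite (eq_bigr (fun=> 1)) => [|j _]; last first.
    by rewrite /z kl -expiMn expi_conjr expr1n.
  by rewrite sumr_const card_ord fmorphV rmorph_nat mulVf ?pnatr_eq0.
have NE : h * N%:R = 2 * pi by rewrite /h divfK// pnatr_eq0.
have zE : z = expi (h * (k%:R - l%:R)).
  by rewrite /z -!expiMn conj_expi -expiD mulrBr !mulr_natr.
(* Two distinct indices below [N] differ by less than [N], so the angle of [z] is nonzero and short
   of a full turn. *)
have z1 : z != 1.
  have h0 : 0 < h by rewrite divr_gt0// mulr_gt0// pi_gt0.
  rewrite zE expi_eq1// normrM gtr0_norm// mulr_gt0 ?normr_gt0 ?subr_eq0 ?eqr_nat//=.
  rewrite -NE ltr_pM2l// ltr_norml.
  have kN : k%:R < N%:R :> R by rewrite ltr_nat.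
  have lN : l%:R < N%:R :> R by rewrite ltr_nat.
  have := ler0n R k; have := ler0n R l; lra.
have zN : z ^+ N = 1.
  rewrite /z exprMn -conjcX -!exprM !(mulnC _ N) !exprM -expiMn -[h *+ N]mulr_natr.
  by rewrite NE expi_2pi !expr1n conjc1 mulr1.
have /eqP := subrX1 z N; rewrite zN subrr eq_sym mulf_eq0 subr_eq0 (negPf z1) /=.
by move=> /eqP ->; rewrite mulr0.
Qed.

Lemma fourier_parseval n (b : 'cV[C]_n) :
  \sum_j (fourier n *m b) j 0 * ((fourier n *m b) j 0)^*%C = \sum_k b k 0 * (b k 0)^*%C.
Proof.
have H (v : 'cV[C]_n) : \sum_(k < n) v k 0 * (v k 0)^*%C = (adj v *m v) 0 0 :> C.
  by rewrite mxE; apply: eq_bigr => k _; rewrite adjointE mulrC.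
by rewrite !H adjointM -mulmxA [X in _ *m X]mulmxA fourier_unitary mul1mx.
Qed.

End Fourier.

(** * The common eigenbasis of the rotations *)

Section Eigenvectors.
Variable R : realType.
Local Notation C := R[i].

(** With boolean labels a [pauliZ] error is a negation, and the label expected in a round is a
    comparison with the register value. *)
Definition eigvec (b : bool) : 'cV[C]_2 :=
  \col_i ((Num.sqrt 2)^-1%:C * (if i == 0 then 1 else if b then 'i else - 'i)).

Lemma inv_sqrt2_sqr : (Num.sqrt 2)^-1%:C * (Num.sqrt 2)^-1%:C = 2^-1 :> C.
Proof.
by rewrite -rmorphM /= -invfM -expr2 sqr_sqrtr// rmorphV ?unitfE//= rmorph_nat.
Qed.

Lemma mul_conj_inv_sqrt2 (a b : C) :
  ((Num.sqrt 2)^-1%:C * a) * ((Num.sqrt 2)^-1%:C * b)^*%C = 2^-1 * (a * b^*%C).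
Proof. by rewrite conjcM conjc_real mulrACA inv_sqrt2_sqr. Qed.

Lemma dot_eigvec b c : adj (eigvec b) *m eigvec c = (b == c)%:R%:M.
Proof.
apply/matrixP => i j; rewrite !mxE !ord1 !big_ord_recl big_ord0 !adjointE !mxE addr0.
rewrite ![_^*%C * _]mulrC !mul_conj_inv_sqrt2 -mulrDr mulr1n.
apply: (canLR (mulKf _)); first by rewrite pnatr_eq0.
case: b c => -[]; rewrite /= ?mulr1 ?mulr0; simpc; rewrite ?subrr.
all: by apply/eqP; rewrite eq_complex /= ?addr0 ?addNr ?eqxx.
Qed.

Lemma sum_outer_eigvec b : outer (eigvec b) + outer (eigvec (~~ b)) = 1%:M.
Proof.
apply/matrixP => i j; rewrite !mxE !big_ord1 !adjointE !mxE !mul_conj_inv_sqrt2 -mulrDr.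
apply: (canLR (mulKf _)); first by rewrite pnatr_eq0.
case: b i j => -[[|[|//]] ?] [[|[|//]] ?] /=; rewrite ?mulr1 ?mulr0; simpc.
all: by apply/eqP; rewrite eq_complex /= ?addr0 ?addNr ?eqxx.
Qed.

Lemma rotE_eigvec t b : rotE t *m eigvec b = expi (if b then t else - t) *: eigvec b.
Proof.
apply/matrixP => i j; rewrite !mxE !big_ord_recl big_ord0 !mxE addr0.
rewrite ![_ * (_^-1%:C * _)]mulrCA -mulrDr; congr (_ * _).
case: b i => -[[|[|//]] ?] /=; rewrite /expi ?cosN ?sinN; simpc.
all: by [].
Qed.

Lemma pauliZ_eigvec b : pauliZ R *m eigvec b = eigvec (~~ b).
Proof.
apply/matrixP => i j; rewrite !mxE !big_ord_recl big_ord0 !mxE addr0.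
rewrite ![_ * (_^-1%:C * _)]mulrCA -mulrDr; congr (_ * _).
case: b i => -[[|[|//]] ?] /=; simpc.
all: by [].
Qed.
End Eigenvectors.

(** * The error-correcting protocol and its outcome distribution *)

Section Protocol.
Variables (R : realType) (n : nat) (a : 'I_n -> R).
Local Notation C := R[i].
Implicit Types (t : R) (r : nat) (k : 'I_n).

Lemma chan_probe_block_vec (eta : R -> R) t (g : 'I_n -> 'cV[C]_2) :
  0 <= eta t <= 1 ->
  chan_probe eta t (outer (block_vec g)) =
  (eta t)%:C *: outer (block_vec (fun k => rotE t *m g k)) +
  (1 - eta t)%:C *: outer (block_vec (fun k => pauliZ R *m (rotE t *m g k))).
Proof.
move=> /andP[eta0 eta1].
have eta1' : 0 <= 1 - eta t by rewrite subr_ge0.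
transitivity (outer (block_vec (fun k => kraus0 eta t *m g k)) +
              outer (block_vec (fun k => kraus1 eta t *m g k))).
  exact: kraus_apply_tens1_block_vec.
congr (_ + _); first exact: outer_block_vec_sqrtZ.
transitivity ((1 - eta t)%:C *: outer (block_vec (fun k => (pauliZ R *m rotE t) *m g k))).
  exact: outer_block_vec_sqrtZ.
by congr (_ *: outer _); apply: eq_block_vec => k; rewrite mulmxA.
Qed.

(* In branch [k] of the ancilla register the probe is in the eigenvector of [rotE t] of eigenvalue [expi t] during the first [k] rounds, and of eigenvalue [expi (- t)] afterwards. *)
Definition probe_state t r : 'cV[C]_(2 * n) :=
  block_vec (fun k => ((a k)%:C * (expi t ^+ minn r k * expi (- t) ^+ (r - k)))
                      *: eigvec R (r < k)%N).

(* For [b = true] the block also undoes a [pauliZ] error, which is witnessed by the probe being in the eigenvector not expected from the value of the register. *)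
Definition correction r (b : bool) : 'M[C]_(2 * n) :=
  block_diag (fun k => eigvec R (r.+1 < k)%N *m adj (eigvec R ((r < k)%N (+) b))).

(** In each block the two Gram matrices are the projectors onto the two orthogonal eigenvectors. *)
Lemma correction_tp r : kraus_tp [:: correction r false; correction r true].
Proof.
apply: kraus_tp2_block_diag => k.
have E c d : adj (eigvec R c *m adj (eigvec R d)) *m (eigvec R c *m adj (eigvec R d)) =
    outer (eigvec R d).
  by rewrite adjointM adjointK mulmxA -[_ *m _ *m eigvec R c]mulmxA dot_eigvec eqxx mulmx1.
by rewrite 2!E addbF addbT sum_outer_eigvec.
Qed.

(** Here [c] tells whether an error occurred. By orthogonality only the operator with [b = c]
    responds, and it prepares the eigenvector due in the next round. *)
Lemma correction_eigvec r b c (z : 'I_n -> C) :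
  correction r b *m block_vec (fun k => z k *: eigvec R ((r < k)%N (+) c)) =
  (b == c)%:R *: block_vec (fun k => z k *: eigvec R (r.+1 < k)%N).
Proof.
rewrite mul_block_diag_vec block_vecZ; apply: eq_block_vec => k.
rewrite -scalemxAr -mulmxA dot_eigvec mul_mx_scalar !scalerA mulrC.
by congr (_ %:R * _ *: _); case: (_ < _)%N b c => -[] [].
Qed.

(** The erroneous and the error-free part of the mixture are corrected to the same pure state; their
    weights add up to 1, and [eta] disappears. *)
Lemma probe_state_step (eta : R -> R) t r : 0 <= eta t <= 1 ->
  kraus_apply [:: correction r false; correction r true]
    (chan_probe eta t (outer (probe_state t r))) = outer (probe_state t r.+1).
Proof.
move=> eta01; rewrite (chan_probe_block_vec _ eta01) [LHS]kraus_apply2_mix.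
pose z k : C := (a k)%:C * (expi t ^+ minn r.+1 k * expi (- t) ^+ (r.+1 - k)).
have rotP k : rotE t *m (((a k)%:C * (expi t ^+ minn r k * expi (- t) ^+ (r - k)))
      *: eigvec R (r < k)%N) = z k *: eigvec R ((r < k)%N (+) false).
  rewrite -scalemxAr rotE_eigvec scalerA addbF /z; congr (_ *: _).
  case: ltnP => rk.
    have -> : minn r.+1 k = r.+1 by lia.
    have -> : (r.+1 - k = r - k)%N by lia.
    by rewrite exprSr; ring.
  have -> : minn r.+1 k = k by lia.
  have -> : (r.+1 - k = (r - k).+1)%N by lia.
  by rewrite exprSr; ring.
have ZrotP k : pauliZ R *m (rotE t *m (((a k)%:C * (expi t ^+ minn r k * expi (- t) ^+ (r - k)))
      *: eigvec R (r < k)%N)) = z k *: eigvec R ((r < k)%N (+) true).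
  by rewrite rotP -scalemxAr pauliZ_eigvec addbF addbT.
rewrite (eq_block_vec rotP) (eq_block_vec ZrotP).
rewrite (correction_eigvec r false false) (correction_eigvec r true false).
rewrite (correction_eigvec r false true) (correction_eigvec r true true).
rewrite -/(probe_state t r.+1) /=; set u := probe_state _ _.
rewrite !scale0r !scale1r outer0 addr0 add0r -scalerDl -rmorphD.
by rewrite addrC subrK scale1r.
Qed.

(** No phase is acquired before the first round, so the initial state can be prepared without
    knowing [t]. *)
Lemma probe_state0 t : probe_state t 0 = probe_state 0 0.
Proof. by apply: eq_block_vec => k; rewrite min0n sub0n !expr0. Qed.

Definition outcome_angle (j : 'I_n) : R := 2 * pi / n%:R * j%:R.

(** The measurement ignores the probe and reads the register in the Fourier basis. The estimate
    folds the outcome angle into the range of [2 * t], then halves it. *)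
Definition phase_protocol : protocol R n :=
  @Protocol R n n (outer (probe_state 0 0))
    (fun r => [:: correction r false; correction r true]) n
    (fun j => (1%:M : 'M[C]_2) *t (adj (row j (fourier R n)) *m row j (fourier R n)))
    (fun j => acos (cos (outcome_angle j)) / 2).

Lemma state_phase_protocol (eta : R -> R) t r : 0 <= eta t <= 1 ->
  @state R n phase_protocol eta t r = outer (probe_state t r).
Proof.
move=> eta01; elim: r => [|r IHr]; first by rewrite probe_state0.
by rewrite -(probe_state_step r eta01) -IHr.
Qed.

Lemma phase_protocol_valid : \sum_k a k ^+ 2 = 1 -> protocol_valid phase_protocol.
Proof.
move=> a1; split; [split|split] => /=.
- exact: psd_outer.
- rewrite mxtrace_mulC [LHS]big_ord1 dot_block_vec -[1]/(1%:C) -a1 rmorph_sum.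
  apply: eq_bigr => k _. rewrite adjointZ -scalemxAl -scalemxAr scalerA dot_eigvec eqxx.
  rewrite min0n sub0n !expr0 !mulr1 conjc_real scalemx1 mxE mulr1n.
  by rewrite -rmorphM -expr2.
- by move=> k _; exact: correction_tp.
split=> [j|] /=.
  have -> : (1%:M : 'M[C]_2) *t (adj (row j (fourier R n)) *m row j (fourier R n)) =
     adj ((1%:M : 'M[C]_2) *t row j (fourier R n)) *m ((1%:M : 'M[C]_2) *t row j (fourier R n)).
    by rewrite adjoint_tens adjoint1 tensmx_mul mul1mx.
  exact: psd_gram.
transitivity ((1%:M : 'M[C]_2) *t (adj (fourier R n) *m fourier R n)).
  apply/matrixP => i j; rewrite summxE !mxE mulr_sumr; apply: eq_bigr => l _.
  by rewrite !mxE big_ord1 !mxE.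
by rewrite fourier_unitary tens1_block_diag block_diag1.
Qed.

Definition amplitude t (j : 'I_n) : C :=
  (Num.sqrt n%:R)^-1%:C * \sum_k (a k)%:C * expi (2 * t - outcome_angle j) ^+ k.

Lemma outcome_prob_phase_protocol (eta : R -> R) t (j : 'I_n) : 0 <= eta t <= 1 ->
  (@outcome_prob R n phase_protocol eta t j)%:C = amplitude t j * (amplitude t j)^*%C.
Proof.
move=> eta01; rewrite /outcome_prob state_phase_protocol//=.
pose c : 'cV[C]_n := \col_k ((a k)%:C * (expi t ^+ minn n k * expi (- t) ^+ (n - k))).
(* All register values are below [n], so after [n] rounds the probe is in the same eigenvector in
   every branch and is disentangled from the register. *)
have -> : probe_state t n = block_vec (fun k => c k 0 *: eigvec R false).
  by apply: eq_block_vec => k; rewrite mxE ltnNge (ltnW (ltn_ord k)).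
set F := row j (fourier R n).
have cE : (F *m c) 0 0 = expi (- t) ^+ n * amplitude t j.
  rewrite mxE mulrCA !mulr_sumr; apply: eq_bigr => k _; rewrite !mxE.
  have kn : (k <= n)%N := ltnW (ltn_ord k).
  (* Branch [k] carries [expi (2 * t) ^+ k] times the common phase [expi (- t) ^+ n], which later
     cancels against its conjugate. *)
  have phaseE : (expi (2 * pi / n%:R) ^+ (j * k))^*%C * (expi t ^+ k * expi (- t) ^+ (n - k)) =
      expi (- t) ^+ n * expi (2 * t - outcome_angle j) ^+ k.
    rewrite conjcX conj_expi -!expiMn -!expiD; congr expi.
    rewrite -[- (2 * pi / n%:R) *+ _]mulr_natr -[t *+ k]mulr_natr -[- t *+ (n - k)]mulr_natr.
    rewrite -[- t *+ n]mulr_natr -[(2 * t - _) *+ k]mulr_natr natrM (natrB _ kn) /outcome_angle.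
    ring.
  rewrite (minn_idPr kn) [LHS]mulrACA [RHS](_ : _ = (Num.sqrt n%:R)^-1%:C * (a k)%:C *
    (expi (- t) ^+ n * expi (2 * t - outcome_angle j) ^+ k)); last by ring.
  by congr (_ * _).
rewrite trace_mul_outer mul_1tens_block_vec dot_block_vec.
have -> : \sum_k (adj (c k 0 *: eigvec R false) *m
      ((adj F *m F *m c) k 0 *: eigvec R false)) 0 0 = (adj c *m (adj F *m F *m c)) 0 0.
  rewrite [RHS]mxE; apply: eq_bigr => k _.
  rewrite adjointZ -scalemxAl -scalemxAr scalerA dot_eigvec eqxx scalemx1 adjointE.
  by rewrite mxE mulr1n.
rewrite -mulmxA mulmxA -adjointM mxE big_ord1 adjointE cE.
rewrite conjcM mulrACA [_^*%C * (expi _ ^+ _)]mulrC conjcX -exprMn expi_conjr expr1n mul1r.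
by rewrite [_^*%C * _]mulrC RRe_real// ger0_real// mulcJ_ge0.
Qed.

End Protocol.

(** * From the mean squared error to the increments of the amplitudes *)

Section MeanSquaredError.
Variables (R : realType) (n : nat) (A : nat -> R).
Hypotheses (A0 : A 0%N = 0) (An : A n = 0).
Local Notation C := R[i].
Local Notation a := (fun k : 'I_n => A k).

(* Summation by parts; the boundary terms vanish because [A] does at both ends. *)
Lemma mul_amplitude_sub1 t j :
  amplitude a t j * (expi (2 * t - outcome_angle R j) - 1) =
  - expi (2 * t - outcome_angle R j) *
    (fourier R n *m \col_k ((A k.+1 - A k)%:C * expi (2 * t) ^+ k)) j 0.
Proof.
set z := expi _.
have -> : (fourier R n *m \col_k ((A k.+1 - A k)%:C * expi (2 * t) ^+ k)) j 0 =
    (Num.sqrt n%:R)^-1%:C * \sum_(k < n) (A k.+1 - A k)%:C * z ^+ k.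
  rewrite mxE mulr_sumr; apply: eq_bigr => k _; rewrite !mxE.
  have zE : z ^+ k = (expi (2 * pi / n%:R) ^+ (j * k))^*%C * expi (2 * t) ^+ k.
    rewrite conjcX conj_expi exprM -exprMn -expiMn -expiD -mulr_natr.
    by congr (expi _ ^+ _); rewrite /outcome_angle; ring.
  by rewrite zE [LHS]mulrACA; ring.
rewrite /amplitude -/z -mulrA [RHS]mulrCA; congr (_ * _).
have shift : \sum_(k < n) (A k.+1)%:C * z ^+ k.+1 = \sum_(k < n) (A k)%:C * z ^+ k.
  apply: (@addrI _ ((A 0)%:C * z ^+ 0)).
  rewrite -(big_ord_recl n (fun k => (A k)%:C * z ^+ k)) big_ord_recr /= An A0.
  by rewrite !mul0r addrC.
rewrite mulrBr mulr1 -{2}shift mulr_suml -sumrB mulr_sumr; apply: eq_bigr => k _.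
by rewrite rmorphB exprS /=; ring.
Qed.

(** Probability times squared chord is the squared modulus of the left side of [mul_amplitude_sub1].
    The unit factor drops out, and Parseval removes the Fourier transform. *)
Lemma expected_chordal_error (eta : R -> R) t : 0 <= eta t <= 1 ->
  \sum_(j < n) @outcome_prob R n (phase_protocol a) eta t j *
               (2 * (1 - cos (2 * t - outcome_angle R j))) =
  \sum_(k < n) (A k.+1 - A k) ^+ 2.
Proof.
move=> eta01; apply: complexI; rewrite !rmorph_sum /=.
pose d : 'cV[C]_n := \col_k ((A k.+1 - A k)%:C * expi (2 * t) ^+ k).
transitivity (\sum_j (fourier R n *m d) j 0 * ((fourier R n *m d) j 0)^*%C).
  apply: eq_bigr => j _; rewrite rmorphM /= outcome_prob_phase_protocol//.
  rewrite -sub_expi_sqr mulrACA -conjcM mul_amplitude_sub1 -/d conjcM mulrACA.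
  by rewrite (rmorphN conjc) /= mulrNN expi_conjr mul1r.
rewrite fourier_parseval; apply: eq_bigr => k _; rewrite mxE conjcM mulrACA.
by rewrite conjcX -exprMn expi_conjr expr1n mulr1 conjc_real -rmorphM expr2.
Qed.

Lemma mse_phase_protocol_le (eta : R -> R) t : 0 <= t <= pi / 2 -> 0 <= eta t <= 1 ->
  mse (phase_protocol a) eta t <= \sum_(k < n) (A k.+1 - A k) ^+ 2.
Proof.
move=> t01 eta01; rewrite -(expected_chordal_error eta01) /mse.
apply: ler_sum => j _; apply: ler_wpM2l; last exact: estimator_error.
by rewrite -ler0c outcome_prob_phase_protocol// mulcJ_ge0.
Qed.

End MeanSquaredError.

(** * Sine amplitudes and the final bound *)

Lemma phase_estimation (R : realType) (n : nat) : (1 < n)%N ->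
  exists2 P : protocol R n, protocol_valid P &
    forall (eta : R -> R) t, 0 <= t <= pi / 2 -> 0 <= eta t <= 1 ->
      mse P eta t <= (pi / n%:R) ^+ 2.
Proof.
move=> n1; have n0 : (0 < n)%N by lia.
have nR : 0 < n%:R :> R by rewrite ltr0n.
have pi0 := @pi_gt0 R; set h : R := pi / n%:R.
have h0 : 0 < h by rewrite divr_gt0.
have hpi : h < pi by rewrite ltr_pdivrMr// ltr_pMr// ltr1n.
set S := \sum_(k < n) sin (h * k%:R) ^+ 2.
have S0 : 0 < S.
  (* The term of index 1 is [sin h ^+ 2], which is positive because [h] lies strictly between [0]
     and [pi] when [1 < n]. *)
  rewrite /S (bigD1 (Ordinal n1)) //= ltr_wpDr//.
    by apply: sumr_ge0 => k _; exact: sqr_ge0.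
  by rewrite mulr1 exprn_gt0// sin_gt0_pi// h0.
have S2 : (Num.sqrt S) ^-1 ^+ 2 = S^-1 by rewrite exprVn sqr_sqrtr// ltW.
pose A k := (Num.sqrt S)^-1 * sin (h * k%:R).
exists (phase_protocol (fun k : 'I_n => A k)).
  apply: phase_protocol_valid; rewrite /A.
  under eq_bigr do rewrite exprMn S2.
  by rewrite -mulr_sumr mulVf// gt_eqF.
move=> eta t t01 eta01.
apply: (le_trans (mse_phase_protocol_le _ _ t01 eta01)).
- by rewrite /A mulr0 sin0 mulr0.
- by rewrite /A divfK ?gt_eqF// sinpi mulr0.
rewrite /A; under eq_bigr do rewrite -mulrBr exprMn S2.
rewrite -mulr_sumr sin_step_sqr_sum// -/h -/S mulrCA mulVf ?gt_eqF// mulr1.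
by apply: one_sub_cos_le; rewrite !ltW.
Qed.

Theorem mainTheorem3 (R : realType) (eta : R -> R)
  (heta : forall t : R, 0 <= t <= pi / 2 -> 0 <= eta t <= 1) :
  exists (c : R) (N0 : nat), forall N : nat, (N0 <= N)%N ->
    exists P : protocol R N, protocol_valid P /\
      forall t : R, 0 <= t <= pi / 2 ->
        Num.sqrt (mse P eta t) <= c * ln (N%:R) / N%:R.
Proof.
(* The bound obtained is [pi / N]; from [N = 2] on, [ln N / ln 2] is at least 1, which gives the
   constant. *)
exists (pi / ln 2), 2%N => N N2; have [P validP mseP] := phase_estimation R N2.
have pi0 := @pi_ge0 R.
exists P; split=> // t t01; apply: (@le_trans _ _ (pi / N%:R)).
  rewrite -[leRHS]ger0_norm ?divr_ge0// -sqrtr_sqr ler_wsqrtr//.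
  exact: mseP (heta _ t01).
rewrite ler_wpM2r ?invr_ge0// mulrAC ler_pdivlMr ?ln_gt0 ?ltr1n// ler_wpM2l//.
by rewrite ler_ln ?posrE ?ltr0n ?ler_nat// (leq_trans _ N2).
Qed.
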